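(* Let $G$ be a graph of order $n$ and let $p$ be a positive integer such that the $p$-domination number satisfies $\gamma_p(G)>p$. Suppose $G$ has a minimum $p$-dominating set $X$ such that every $p$-element subset $Y\subseteq X$ has an external private neighbor, i.e. a vertex $u\in V(G)\setminus X$ with $N(u)\cap X=Y$. Then for every adjacency eigenvalue $\lambda$ of $G$, and also for every Laplacian eigenvalue $\lambda$ of $G$, it holds that $\gamma_p(G)\leq n-m_G(\lambda)$, where $m_G(\lambda)$ is the multiplicity of $\lambda$ as an eigenvalue of the corresponding matrix.
   Context: Graphs are finite, simple and undirected. $A(G)$ is the adjacency matrix and $L(G)=D(G)-A(G)$ the Laplacian matrix, with $D(G)$ the diagonal degree matrix. $N(u)$ is the set of neighbors of $u$. A set $S\subseteq V(G)$ is $p$-dominating if every vertex of $V(G)\setminus S$ is adjacent to at least $p$ vertices of $S$; $\gamma_p(G)$ is the minimum size of a $p$-dominating set. *)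

(* Defs.v *)
From mathcomp Require Import all_boot all_order all_algebra.

Set Implicit Arguments.
Unset Strict Implicit.
Unset Printing Implicit Defensive.

Import Order.TTheory GRing.Theory Num.Theory.
Local Open Scope ring_scope.

Section GraphNotions.

(* A finite simple graph is a finType of vertices with an adjacency relation,
   assumed symmetric and irreflexive where the definitions below are used. *)
Variables (V : finType) (adj : rel V).

Definition nbr (u : V) : {set V} := [set v | adj u v].

Definition p_dominating (p : nat) (S : {set V}) : bool :=
  [forall u in ~: S, (p <= #|nbr u :&: S|)%N].

Definition p_domination_number (p : nat) : nat :=
  #|[arg min_(S < [set: V] | p_dominating p S) #|S| ]|.

(* The starting point [set: V] of the arg min is p-dominating, so the minimum
   is taken over a nonempty family. *)
Lemma p_dominatingT (p : nat) : p_dominating p [set: V].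
Proof. by apply/forall_inP => u; rewrite !inE. Qed.

Lemma p_domination_numberP (p : nat) :
  (exists2 S, p_dominating p S & #|S| = p_domination_number p) /\
  (forall S, p_dominating p S -> (p_domination_number p <= #|S|)%N).
Proof.
rewrite /p_domination_number; case: arg_minnP => [|S domS minS].
  exact: p_dominatingT.
by split; first exists S.
Qed.

Definition min_p_dominating (p : nat) (X : {set V}) : Prop :=
  p_dominating p X /\ #|X| = p_domination_number p.

(* Matrices are indexed by 'I_#|V| through the enumeration of V. *)
Definition adjacency_mx (R : pzRingType) : 'M[R]_#|V| :=
  \matrix_(i, j) (adj (enum_val i) (enum_val j))%:R.

Definition degree_mx (R : pzRingType) : 'M[R]_#|V| :=
  diag_mx (\row_i #|nbr (enum_val i)|%:R).

Definition laplacian_mx (R : pzRingType) : 'M[R]_#|V| :=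
  degree_mx R - adjacency_mx R.

End GraphNotions.

(* Algebraic multiplicity. For the real symmetric matrices above it equals the
   dimension of the eigenspace. *)
Definition eig_mult (R : fieldType) (n : nat) (M : 'M[R]_n) (lambda : R) : nat :=
  mup lambda (char_poly M).

(* Main.v *)
Require Import Defs.
From mathcomp Require Import all_boot all_order all_algebra.

(** The rows of [A - lambda I] (or of [L - lambda I]) indexed by [X], restricted
    to the columns of the private neighbors, form up to sign the incidence
    matrix between [X] and its [p]-subsets, since the diagonal is never met.
    If the values of [g] sum to zero on every [p]-subset of [X], exchanging one
    element of a subset shows that [g] is constant on [X], hence zero because
    [0 < p < #|X|]. So the rank of the shifted matrix is at least [#|X|].

    For a symmetric matrix [M] over a real field, write a full rank
    factorization [M - a I = C B].  Sylvester's identity relates the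
    characteristic polynomial of [a I + C B] to that of [a I + B C], and [B C]
    is invertible because the kernel and the image of [M - a I] are orthogonal;
    hence the multiplicity of [a] is the corank of [M - a I]. *)

Import Order.TTheory GRing.Theory Num.Theory.
Local Open Scope ring_scope.

(* Both sides come from the determinant of [[t I, A], [B, I]] with
   [t = 'X - a], eliminating either [B] or [A]. *)
Lemma char_poly_mulmxC (R : comNzRingType) (m n : nat) (a : R)
    (A : 'M[R]_(m, n)) (B : 'M[R]_(n, m)) :
  char_poly (a%:M + A *m B) * ('X - a%:P) ^+ n =
  ('X - a%:P) ^+ m * char_poly (a%:M + B *m A).
Proof.
set t := 'X - a%:P.
have shift k l (P : 'M[R]_(k, l)) (Q : 'M[R]_(l, k)) :
    char_poly_mx (a%:M + P *m Q) =
    t%:M - map_mx polyC P *m map_mx polyC Q.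
  rewrite /char_poly_mx map_mxD map_scalar_mx map_mxM /= opprD addrA.
  by rewrite -raddfB.
rewrite /char_poly !shift; set A' := map_mx _ A; set B' := map_mx _ B.
pose W := block_mx t%:M A' B' 1%:M.
have detl : \det (W *m block_mx 1%:M 0 (- B') 1%:M) = \det (t%:M - A' *m B').
  rewrite mulmx_block !mulmx1 !mulmx0 !mul1mx !add0r mulmxN.
  by rewrite subrr det_ublock det1 mulr1.
have detr : \det (block_mx 1%:M 0 (- B') t%:M *m W) =
    t ^+ m * \det (t%:M - B' *m A').
  rewrite mulmx_block !mulmx1 !mul0mx !mul1mx !addr0 !mulNmx.
  rewrite mul_mx_scalar mul_scalar_mx addrC subrr.
  by rewrite det_ublock det_scalar addrC.
by rewrite -detr -detl !det_mulmx !det_lblock !det1 det_scalar !mul1r mulr1 mulrC.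
Qed.

Lemma mulmx_tr_eq0 (R : realFieldType) (n : nat) (v : 'rV[R]_n) :
  v *m v^T = 0 -> v = 0.
Proof.
move/matrixP/(_ 0 0); rewrite !mxE => v0.
apply/rowP => i; rewrite mxE; apply/eqP; rewrite -sqrf_eq0 expr2; apply/eqP.
have /psumr_eq0P : forall j, true -> 0 <= v 0 j * v^T j 0.
  by move=> j _; rewrite mxE -expr2 sqr_ge0.
by move/(_ v0 i isT); rewrite mxE.
Qed.

Lemma mup_char_poly_symmetric (R : realFieldType) (n : nat) (M : 'M[R]_n) (a : R) :
  M^T = M -> mup a (char_poly M) = (n - \rank (M - a%:M)%R)%N.
Proof.
move=> symM; set N := M - a%:M.
have symN : N^T = N by rewrite /N linearB /= symM tr_scalar_mx.
have defN := mulmx_base N.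
have := char_poly_mulmxC _ _ _ a (col_base N) (row_base N).
rewrite defN addrC subrK => sylv.
have mupX k : mup a (('X - a%:P) ^+ k) = k by rewrite mup_XsubCX eqxx.
have nz_cp k (P : 'M[R]_k) : char_poly P != 0.
  exact/monic_neq0/char_poly_monic.
have nz_X k : ('X - a%:P) ^+ k != 0 by rewrite expf_neq0 ?polyXsubC_eq0.
(* An eigenvector [v] for [a] would satisfy [v *m row_base N *m col_base N = 0], so
   [w = v *m row_base N] is killed by [N]. Also [w = z *m N] for some [z], and symmetry gives
   [w *m w^T = z *m (w *m N)^T = 0]. *)
have nroot : ~~ root (char_poly (a%:M + row_base N *m col_base N)) a.
  rewrite -eigenvalue_root_char; apply/eigenvalueP => -[v].
  rewrite mulmxDr mul_mx_scalar -[RHS]addr0 => /addrI vBC /negP; apply.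
  have vN : v *m row_base N *m N = 0.
    by rewrite -[X in _ *m X]defN mulmxA -(mulmxA v) vBC mul0mx.
  have /submxP[z defz] : (v *m row_base N <= N)%MS.
    by rewrite (submx_trans (submxMl _ _)) ?eq_row_base.
  have /mulmx_tr_eq0 vB : (v *m row_base N) *m (v *m row_base N)^T = 0.
    by rewrite {1}defz -mulmxA -{1}symN -trmx_mul vN trmx0 mulmx0.
  apply/eqP/(row_free_inj (row_base_free N)).
  by rewrite vB mul0mx.
(* Comparing the orders of vanishing at [a] on both sides: multiplicity plus rank equals [n]. *)
have := congr1 (mup a) sylv.
rewrite !mupM ?nz_cp ?nz_X // !mupX (mupNroot nroot) addn0 => e.
by rewrite -[X in (X - _)%N]e addnK.
Qed.

Lemma card_subsetP (T : finType) (A : {set T}) (k : nat) :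
  (k <= #|A|)%N -> exists2 B : {set T}, B \subset A & #|B| = k.
Proof.
move=> kA; have : (0 < #|[set B : {set T} | B \subset A & #|B| == k]|)%N.
  by rewrite cards_draws bin_gt0.
by case/card_gt0P => B; rewrite inE => /andP[sBA /eqP]; exists B.
Qed.

Lemma sum_subsets_eq0 (R : numDomainType) (T : finType) (X : {set T}) (p : nat)
    (g : T -> R) :
  (0 < p < #|X|)%N ->
  (forall Y : {set T}, Y \subset X -> #|Y| = p -> \sum_(y in Y) g y = 0) ->
  {in X, forall x, g x = 0}.
Proof.
move=> /andP[p_gt0 pX] sum0 x xX.
have g_const y : y \in X -> g y = g x.
  move=> yX; have [->//|neq_yx] := eqVneq y x.
  have yX' : y \in X :\ x by rewrite !inE neq_yx.
  (* Adding either [x] or [y] to [Z] gives a [p]-subset of [X]; there is room for [Z] because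
     [p < #|X|]. *)
  have [Z sZ cardZ] : exists2 Z : {set T}, Z \subset X :\ x :\ y & #|Z| = p.-1.
    apply: card_subsetP; move: pX.
    by rewrite (cardsD1 x X) xX (cardsD1 y) yX' -{1}(prednK p_gt0) !add1n !ltnS.
  have sZX : Z \subset X by rewrite (subset_trans sZ) // !subDset !setUA subsetUr.
  have sum_add z : z \in X -> z \notin Z -> g z = - \sum_(i in Z) g i.
    move=> zX zZ; apply/eqP; rewrite -addr_eq0 -big_setU1 //=; apply/eqP/sum0.
      by rewrite subUset sub1set zX.
    by rewrite cardsU1 zZ cardZ add1n prednK.
  rewrite !sum_add //; first by apply/negP => /(subsetP sZ); rewrite !inE eqxx andbF.
  by apply/negP => /(subsetP sZ); rewrite !inE eqxx.
have [Y sYX cardY] := card_subsetP _ X p (ltnW pX).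
have := sum0 Y sYX cardY.
rewrite (eq_bigr (fun=> g x)) => [|y /(subsetP sYX)/g_const//].
by rewrite sumr_const cardY => /eqP; rewrite mulrn_eq0 -leqn0 leqNgt p_gt0 => /eqP.
Qed.

(** The hypothesis is linear independence of the rows indexed by [X], with coefficients given on
    vertices rather than on matrix indices. *)
Lemma leq_card_mxrank (F : fieldType) (V : finType) (M : 'M[F]_#|V|) (X : {set V}) :
  (forall g : V -> F,
     (forall u, \sum_(x in X) g x * M (enum_rank x) (enum_rank u) = 0) ->
     {in X, forall x, g x = 0}) ->
  (#|X| <= \rank M)%N.
Proof.
move=> indep; pose f (i : 'I_#|X|) := enum_rank (enum_val i).
have : row_free (rowsub f M).
  rewrite -kermx_eq0; apply/rowV0P => v /sub_kermxP vM.
  (* This sum has at most one term: [g] carries [v] over to [X] and is zero elsewhere. *)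
  pose g x := \sum_(i < #|X| | enum_val i == x) v 0 i.
  have gE i : g (enum_val i) = v 0 i.
    rewrite /g (bigD1 i) //= big1 ?addr0 // => j /andP[/eqP/enum_val_inj->].
    by rewrite eqxx.
  apply/rowP => i; rewrite mxE -gE; apply: indep (enum_valP i) => u.
  have /matrixP/(_ 0 (enum_rank u)) := vM; rewrite !mxE => vMu.
  rewrite big_enum_val -[RHS]vMu; apply: eq_bigr => j _.
  by rewrite gE mxE.
rewrite -row_leq_rank => /leq_trans; apply.
exact/mxrankS/rowsub_sub.
Qed.

Section PrivateNeighbors.

Variables (R : realFieldType) (V : finType) (adj : rel V).
Hypothesis adj_sym : symmetric adj.

Lemma tr_adjacency_mx : (adjacency_mx adj R)^T = adjacency_mx adj R.
Proof. by apply/matrixP => i j; rewrite !mxE adj_sym. Qed.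

Lemma tr_laplacian_mx : (laplacian_mx adj R)^T = laplacian_mx adj R.
Proof. by rewrite /laplacian_mx linearB /= tr_adjacency_mx tr_diag_mx. Qed.

Variables (p : nat) (X : {set V}).
Hypothesis pX : (0 < p < #|X|)%N.
Hypothesis X_priv : forall Y : {set V}, Y \subset X -> #|Y| = p ->
  exists2 u : V, u \notin X & nbr adj u :&: X = Y.

(** The factor [c] is [1] for the adjacency matrix and [-1] for the Laplacian. Diagonal entries stay
    free, so a scalar shift is covered too. *)
Lemma mxrank_private_neighbors (c : R) (M : 'M[R]_#|V|) :
  c != 0 ->
  (forall x u, x != u -> M (enum_rank x) (enum_rank u) = c * (adj x u)%:R) ->
  (#|X| <= \rank M)%N.
Proof.
move=> c_neq0 ME; apply: leq_card_mxrank => g gM.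
apply: (sum_subsets_eq0 _ _ X p) => // Y sYX cardY.
have [u uX defY] := X_priv Y sYX cardY.
apply: (mulfI c_neq0); rewrite mulr0 -[RHS](gM u) mulr_sumr -defY.
(* In column [u], only the neighbors of [u] in [X], which form [Y], contribute. *)
rewrite [RHS](bigID (adj u)) /= [X in _ = _ + X]big1 => [|x /andP[xX /negbTE ux]].
  rewrite addr0; apply: eq_big => [x|x]; first by rewrite !inE andbC.
  rewrite !inE => /andP[ux xX]; rewrite ME ?(adj_sym x) ?ux ?mulr1 1?mulrC //.
  by apply: contraNneq uX => <-.
rewrite ME ?(adj_sym x) ?ux ?mulr0 //.
by apply: contraNneq uX => <-.
Qed.

Lemma mup_private_neighbors (c a : R) (M : 'M[R]_#|V|) :
  M^T = M -> c != 0 ->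
  (forall x u, x != u -> M (enum_rank x) (enum_rank u) = c * (adj x u)%:R) ->
  (#|X| <= #|V| - eig_mult M a)%N.
Proof.
move=> symM c_neq0 ME; rewrite /eig_mult mup_char_poly_symmetric //.
rewrite subKn ?rank_leq_row //; apply: (mxrank_private_neighbors c) => // x u neq_xu.
by rewrite -ME // !mxE (inj_eq enum_rank_inj) (negbTE neq_xu) subr0.
Qed.

End PrivateNeighbors.

Local Close Scope ring_scope.

Theorem theorem4p4 (R : rcfType) (V : finType) (adj : rel V)
  (adj_sym : symmetric adj) (adj_irr : irreflexive adj)
  (p : nat) (p_gt0 : 0 < p)
  (gamma_gt : p < p_domination_number adj p)
  (X : {set V}) (X_min : min_p_dominating adj p X)
  (X_priv : forall Y : {set V}, Y \subset X -> #|Y| = p ->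
     exists2 u : V, u \notin X & nbr adj u :&: X = Y) :
  (forall lambda : R, eigenvalue (adjacency_mx adj R) lambda ->
     p_domination_number adj p
       <= #|V| - eig_mult (adjacency_mx adj R) lambda) /\
  (forall lambda : R, eigenvalue (laplacian_mx adj R) lambda ->
     p_domination_number adj p
       <= #|V| - eig_mult (laplacian_mx adj R) lambda).
Proof.
have [_ cardX] := X_min; rewrite -cardX in gamma_gt *.
have pX : 0 < p < #|X| by rewrite p_gt0.
split=> lambda _.
  apply: (mup_private_neighbors _ _ _ adj_sym _ _ pX X_priv 1%R) => [||x u _].
  - exact: tr_adjacency_mx.
  - exact: oner_neq0.
  - by rewrite !mxE !enum_rankK mul1r.
apply: (mup_private_neighbors _ _ _ adj_sym _ _ pX X_priv (-1)%R) => [||x u neq_xu].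
- exact: tr_laplacian_mx.
- by rewrite oppr_eq0 oner_neq0.
- by rewrite !mxE !enum_rankK (inj_eq enum_rank_inj) (negbTE neq_xu) mulr0n sub0r mulN1r.
Qed.
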